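(* Let $(X,A)$ be a polyhedral pair with a nested triangulation $\{(T^n,S^n)\}_{n=0}^\infty$, let $(L_n)_{n=0}^\infty$ be positive reals with $\sum_n L_n<\infty$, and let $\mathbb{B}=\{\mathcal{K}_v\}_{v\in V}$ be the associated Schauder basis of $\mathrm{Lip}_c(X,A)$. Then $\mathbb{B}$ is minimal for the vectorization $F_{\mathbb{B}}$ on $\hat{\mathcal{M}}_1(X,A)$; that is, for any $v\in V$ there exist $\alpha,\beta\in\hat{\mathcal{M}}_1(X,A)$ with $\alpha\neq\beta$ such that $\alpha(\mathcal{K}_{v'})=\beta(\mathcal{K}_{v'})$ for all $v'\in V$ with $v'\neq v$.
   Context: A polyhedron $X\subset\mathbb{R}^d$ is a finite intersection of closed half-spaces. A polyhedral pair $(X,A)$ consists of a polyhedron $X$ and a nonempty proper subset $A\subsetneq X$ that is a finite union of sub-polyhedra of $X$. $X$ carries the Euclidean metric $d$. A map from the geometric realization of a simplicial complex $T$ to a real vector space is piecewise linear (p.l.) on $T$ if its value at a point $\sum_i a_iv_i$ (barycentric coordinates in a simplex $\langle v_0,\dots,v_p\rangle$) is $\sum_i a_if(v_i)$. A p.l. triangulation of $(X,A)$ is a simplicial complex $T$ with a subcomplex $S$ and a homeomorphism of pairs $(|T|,|S|)\to(X,A)$ that is p.l. on $T$; the homeomorphism is suppressed. A nested triangulation of $(X,A)$ is a sequence $\{(T^n,S^n)\}_{n\ge0}$ of p.l. triangulations of $(X,A)$ such that each $T^{n+1}$ is a refinement of $T^n$ (every simplex of $T^{n+1}$ is contained in a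 simplex of $T^n$) and $\sup_{\sigma\in T^n}\mathrm{diam}(\sigma)\to0$. A function on $X$ is $n$-linear if it is p.l. on $T^n$. $V^n$ is the set of vertices of $T^n$ that are not vertices of $S^n$; $V^{(n)}=V^n\setminus V^{n-1}$ (with $V^{-1}=\emptyset$); $V=\bigcup_nV^{(n)}$. For $v\in V^{(n)}$, $\mathcal{K}_v:X\to\mathbb{R}$ is the unique function that vanishes on $A$, is $n$-linear, satisfies $\mathcal{K}_v(v')=0$ for all $v'\in V^n$ with $v'\ne v$, has $\mathcal{K}_v(v)>0$, and has best Lipschitz constant $L_n$. $\mathrm{Lip}_c(X,A)$ is the space of compactly supported Lipschitz functions on $X$ vanishing on $A$. Relative Radon measures: $\mathcal{B}^+(X)$ is the commutative monoid of (unsigned) Borel measures on $X$ and $\mathcal{B}^+(X,A)=\mathcal{B}^+(X)/\mathcal{B}^+(A)$. Let $d_A(x)=d(x,A)$ and, for a Borel set $U$, $\alpha_U(E)=\alpha(E\cap U)$. $\hat{\mathcal{M}}_1^+(X,A)$ is the set of $\alpha\in\mathcal{B}^+(X,A)$ that are tight (inner regular with respect to compact sets) and such that every $x\in X$ has a neighborhood $U$ with $\alpha_U(d_A)<\infty$. $\hat{\mathcal{M}}_1(X,A)$ is the Grothendieck completion of $\hat{\mathcal{M}}_1^+(X,A)$. For a function $f$ and a measure $\alpha$, $\alpha(f)=\int_Xf\,d\alpha$; for $\alpha=(\alpha^+,\alpha^-)\in\hat{\mathcal{M}}_1(X,A)$, $\alpha(f)=\alpha^+(f)-\alpha^-(f)$.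 The vectorization is $F_{\mathbb{B}}(\alpha)=(\alpha(f))_{f\in\mathbb{B}}$. *)

(* Defs.v *)
From HB Require Import structures.
From mathcomp Require Import all_boot all_order all_algebra.
From mathcomp Require Import finmap.
From mathcomp Require Import all_classical all_reals all_analysis.

Set Implicit Arguments.
Unset Strict Implicit.
Unset Printing Implicit Defensive.

Import Order.TTheory GRing.Theory Num.Theory.
Import numFieldNormedType.Exports.

Local Open Scope classical_set_scope.
Local Open Scope ring_scope.

(* The library norm on ['rV[R]_d] is the sup norm; it induces the Euclidean
   topology, but Lipschitz constants and distances need the Euclidean metric. *)
Definition edist (R : realType) (d : nat) (x y : 'rV[R]_d) : R :=
  Num.sqrt (\sum_(i < d) (x ord0 i - y ord0 i) ^+ 2).

Definition dist_to (R : realType) (d : nat) (A : set 'rV[R]_d)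
  (x : 'rV[R]_d) : R := inf [set edist x a | a in A].

Definition diam (R : realType) (d : nat) (E : set 'rV[R]_d) : \bar R :=
  ereal_sup [set z | exists x y, [/\ E x, E y & z = (edist x y)%:E]].

Definition lipschitz_const (R : realType) (d : nat) (X : set 'rV[R]_d)
  (f : 'rV[R]_d -> R) (c : R) : Prop :=
  0 <= c /\ forall x y, X x -> X y -> `|f x - f y| <= c * edist x y.

Definition best_lipschitz_const (R : realType) (d : nat) (X : set 'rV[R]_d)
  (f : 'rV[R]_d -> R) (c : R) : Prop :=
  lipschitz_const X f c /\ forall c', lipschitz_const X f c' -> c <= c'.

Definition closed_half_space (R : realType) (d : nat) (H : set 'rV[R]_d) :
  Prop :=
  exists (a : 'rV[R]_d) (b : R),
    a != 0 /\ H = [set x | \sum_(i < d) a ord0 i * x ord0 i <= b].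

Definition polyhedron (R : realType) (d : nat) (X : set 'rV[R]_d) : Prop :=
  exists (m : nat) (H : 'I_m -> set 'rV[R]_d),
    (forall i, closed_half_space (H i)) /\ X = \bigcap_(i in setT) H i.

Definition polyhedral_pair (R : realType) (d : nat) (X A : set 'rV[R]_d) :
  Prop :=
  [/\ polyhedron X,
      A !=set0,
      A `<` X &
      exists (m : nat) (P : 'I_m -> set 'rV[R]_d),
        (forall i, polyhedron (P i) /\ P i `<=` X) /\
        A = \bigcup_(i in setT) P i].

(* As the homeomorphism of a p.l. triangulation is suppressed, the vertices of
   a complex are taken to be points of R^d. The complex itself is the
   (possibly infinite) set of vertex sets of its simplices. *)
Definition simplicial_complex (R : realType) (d : nat)
  (T : set {fset 'rV[R]_d}) : Prop :=
  (forall s, T s -> s != fset0) /\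
  (forall s t, T s -> t != fset0 -> fsubset t s -> T t).

Definition vertices (R : realType) (d : nat) (T : set {fset 'rV[R]_d}) :
  set 'rV[R]_d := [set v | T (fset1 v)].

Definition cell (R : realType) (d : nat) (s : {fset 'rV[R]_d}) :
  set {ptws 'rV[R]_d -> R} :=
  [set a | [/\ forall v, 0 <= a v,
               forall v, v \notin s -> a v = 0 &
               \sum_(v <- s) a v = 1]].

(* |T|, as a set of barycentric coordinate functions *)
Definition realization (R : realType) (d : nat) (T : set {fset 'rV[R]_d}) :
  set {ptws 'rV[R]_d -> R} := \bigcup_(s in T) cell s.

(* Closed sets of |T| for the weak topology. Pointwise convergence restricts
   to the Euclidean topology on each cell, and each cell is closed for it, so
   closedness relative to the cell is closedness. *)
Definition weakly_closed (R : realType) (d : nat) (T : set {fset 'rV[R]_d})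
  (C : set {ptws 'rV[R]_d -> R}) : Prop :=
  C `<=` realization T /\ forall s, T s -> closed (C `&` cell s).

(* The p.l. map |T| -> R^d that is the identity on vertices; the sum is a
   finite-support sum. *)
Definition bary (R : realType) (d : nat) (a : {ptws 'rV[R]_d -> R}) :
  'rV[R]_d := \sum_(v \in [set: 'rV[R]_d]) a v *: v.

Definition simplex (R : realType) (d : nat) (s : {fset 'rV[R]_d}) :
  set 'rV[R]_d := @bary R d @` cell s.

Definition pl_triangulation (R : realType) (d : nat) (X A : set 'rV[R]_d)
  (T S : set {fset 'rV[R]_d}) : Prop :=
  [/\ simplicial_complex T /\ (simplicial_complex S /\ S `<=` T),
      set_bij (realization T) X (@bary R d),
      forall C, C `<=` realization T ->
        (weakly_closed T C <->
         exists2 F, closed F & @bary R d @` C = X `&` F) &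
      @bary R d @` realization S = A].

Definition refines (R : realType) (d : nat) (T' T : set {fset 'rV[R]_d}) :
  Prop :=
  forall s', T' s' -> exists2 s, T s & simplex s' `<=` simplex s.

Definition mesh (R : realType) (d : nat) (T : set {fset 'rV[R]_d}) : \bar R :=
  ereal_sup [set diam (simplex s) | s in T].

Definition nested_triangulation (R : realType) (d : nat)
  (X A : set 'rV[R]_d) (T S : nat -> set {fset 'rV[R]_d}) : Prop :=
  [/\ forall n, pl_triangulation X A (T n) (S n),
      forall n, refines (T n.+1) (T n) &
      mesh (T n) @[n --> \oo] --> 0%E].

Definition pl_function (R : realType) (d : nat) (T : set {fset 'rV[R]_d})
  (f : 'rV[R]_d -> R) : Prop :=
  forall s a, T s -> cell s a -> f (bary a) = \sum_(v <- s) a v * f v.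

(* V^n, V^(n) and V *)
Definition free_vertices (R : realType) (d : nat)
  (T S : nat -> set {fset 'rV[R]_d}) (n : nat) : set 'rV[R]_d :=
  vertices (T n) `\` vertices (S n).

Definition new_vertices (R : realType) (d : nat)
  (T S : nat -> set {fset 'rV[R]_d}) (n : nat) : set 'rV[R]_d :=
  if n is m.+1 then free_vertices T S m.+1 `\` free_vertices T S m
  else free_vertices T S 0.

Definition all_free_vertices (R : realType) (d : nat)
  (T S : nat -> set {fset 'rV[R]_d}) : set 'rV[R]_d :=
  \bigcup_(n in setT) new_vertices T S n.

(* Functions on X are functions on R^d whose values outside X are ignored. *)
Definition schauder_function (R : realType) (d : nat) (X A : set 'rV[R]_d)
  (T S : nat -> set {fset 'rV[R]_d}) (L : nat -> R) (n : nat)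
  (v : 'rV[R]_d) (f : 'rV[R]_d -> R) : Prop :=
  [/\ forall x, A x -> f x = 0,
      pl_function (T n) f,
      forall v', free_vertices T S n v' -> v' <> v -> f v' = 0,
      0 < f v &
      best_lipschitz_const X f (L n)].

Definition schauder_basis (R : realType) (d : nat) (X A : set 'rV[R]_d)
  (T S : nat -> set {fset 'rV[R]_d}) (L : nat -> R)
  (K : 'rV[R]_d -> 'rV[R]_d -> R) : Prop :=
  forall n v, new_vertices T S n v -> schauder_function X A T S L n v (K v).

Notation borel_measure R d :=
  {measure set (g_sigma_algebraType (@open 'rV[R]_d)) -> \bar R}.

(* For Y closed, Borel measures on Y are identified with their extensions by
   zero to R^d. This is applied to Y = X and Y = A. *)
Definition carried_by (R : realType) (d : nat) (Y : set 'rV[R]_d)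
  (mu : borel_measure R d) : Prop := mu (~` Y) = 0%E.

(* The congruence on B^+(X) with quotient monoid B^+(X,A) = B^+(X)/B^+(A) *)
Definition rel_eq (R : realType) (d : nat) (A : set 'rV[R]_d)
  (mu nu : borel_measure R d) : Prop :=
  exists a b : borel_measure R d,
    [/\ carried_by A a, carried_by A b &
        forall E : set (g_sigma_algebraType (@open 'rV[R]_d)),
          measurable E -> (mu E + a E = nu E + b E)%E].

Definition tight (R : realType) (d : nat) (mu : borel_measure R d) : Prop :=
  forall E : set (g_sigma_algebraType (@open 'rV[R]_d)), measurable E ->
    mu E = ereal_sup [set mu C | C in
                        [set C : set 'rV[R]_d | compact C /\ C `<=` E]].

Definition locally_1_finite (R : realType) (d : nat) (X A : set 'rV[R]_d)
  (mu : borel_measure R d) : Prop :=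
  forall x, X x ->
    exists (U : set (g_sigma_algebraType (@open 'rV[R]_d)))
           (mU : measurable U),
      [/\ U `<=` X, within X (nbhs x) U &
          (\int[mrestr mu mU]_(y in X) (dist_to A y)%:E < +oo)%E].

(* The class of mu belongs to \hat M_1^+(X,A). The second condition does not
   depend on the representative since d_A = 0 on A; a class is tight when it
   has a tight representative (equivalently, when its representative with no
   mass on A is tight). *)
Definition in_M1plus (R : realType) (d : nat) (X A : set 'rV[R]_d)
  (mu : borel_measure R d) : Prop :=
  [/\ carried_by X mu,
      exists nu : borel_measure R d,
        [/\ carried_by X nu, rel_eq A mu nu & tight nu] &
      locally_1_finite X A mu].

(* Formal differences representing the elements of \hat M_1(X,A); equality of
   the elements they represent is [M1_eq]. *)
Record M1 (R : realType) (d : nat) (X A : set 'rV[R]_d) := MkM1 {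
  M1_pos : borel_measure R d;
  M1_neg : borel_measure R d;
  M1_posP : in_M1plus X A M1_pos;
  M1_negP : in_M1plus X A M1_neg }.

Definition M1_eq (R : realType) (d : nat) (X A : set 'rV[R]_d)
  (alpha beta : M1 X A) : Prop :=
  exists2 gamma : borel_measure R d, in_M1plus X A gamma &
    rel_eq A
      (measure_add (measure_add (M1_pos alpha) (M1_neg beta)) gamma)
      (measure_add (measure_add (M1_pos beta) (M1_neg alpha)) gamma).

Definition M1_eval (R : realType) (d : nat) (X A : set 'rV[R]_d)
  (alpha : M1 X A) (f : 'rV[R]_d -> R) : \bar R :=
  (\int[M1_pos alpha]_(x in X) (f x)%:E
   - \int[M1_neg alpha]_(x in X) (f x)%:E)%E.

(* Main.v *)
(* Let v be a new vertex of T^n. In the Schauder expansion of a function f the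
   coefficient of K_v is, up to a factor, f(v) if n = 0 and otherwise the
   difference between f(v) and the value at v of the (n-1)-linear interpolation
   of f. This coefficient functional is integration against delta_v minus a
   finite combination of point masses sum_i a_i delta_{v_i}, where the a_i are
   the barycentric coordinates of v in T^{n-1} (an empty sum when n = 0), and it
   kills every other basis function. The two point-supported measures differ
   because only the first one charges v, which lies off A; the mass at v cannot
   be absorbed by a stabilizing gamma, as local finiteness of gamma(d_A) and
   d_A(v) > 0 force gamma{v} to be finite. *)
From HB Require Import structures.
From mathcomp Require Import all_boot all_order all_algebra.
From mathcomp Require Import finmap.
From mathcomp Require Import all_classical all_reals all_analysis.
From mathcomp Require Import measurable_realfun lra.
Require Import Defs.

Set Implicit Arguments.
Unset Strict Implicit.
Unset Printing Implicit Defensive.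

Import Order.TTheory GRing.Theory Num.Theory.
Import numFieldNormedType.Exports.
Local Open Scope classical_set_scope.
Local Open Scope ring_scope.

(** * Barycentric coordinates and their transport between simplices *)

Definition vertex_coord (R : realType) (d : nat) (v : 'rV[R]_d) :
  {ptws 'rV[R]_d -> R} := fun w => (w == v)%:R.

Lemma cell_vertex_coord (R : realType) (d : nat) (v : 'rV[R]_d)
  (s : {fset 'rV[R]_d}) : v \in s -> cell s (vertex_coord v).
Proof.
move=> vs; split=> [w|w ws|]; rewrite /vertex_coord ?ler0n //.
  by case: eqP => // wv; rewrite wv vs in ws.
by rewrite (bigD1_seq v) ?fset_uniq //= eqxx big1 ?addr0 // => w /negPf ->.
Qed.

Lemma baryE (R : realType) (d : nat) (s : {fset 'rV[R]_d})
  (a : {ptws 'rV[R]_d -> R}) : cell s a -> bary a = \sum_(v <- s) a v *: v.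
Proof.
by case=> _ a0 _; rewrite /bary (fsbigTE s) // => v /a0 ->; rewrite scale0r.
Qed.

Lemma bary_vertex_coord (R : realType) (d : nat) (v : 'rV[R]_d) :
  bary (vertex_coord v) = v.
Proof.
rewrite (baryE (cell_vertex_coord (fset11 v))) big_seq_fset1.
by rewrite /vertex_coord eqxx scale1r.
Qed.

Lemma simplex_vertex (R : realType) (d : nat) (s : {fset 'rV[R]_d}) v :
  v \in s -> simplex s v.
Proof.
move=> vs; exists (vertex_coord v); first exact: cell_vertex_coord.
exact: bary_vertex_coord.
Qed.

(* Barycentric coordinates for [s'] are pushed to barycentric coordinates for
   [s] by replacing each vertex [w] of [s'] by its coordinates [b w]. *)
Definition push_coord (R : realType) (d : nat) (s' : {fset 'rV[R]_d})
  (b : 'rV[R]_d -> {ptws 'rV[R]_d -> R}) (a : {ptws 'rV[R]_d -> R}) :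
  {ptws 'rV[R]_d -> R} := fun u => \sum_(w <- s') a w * b w u.

Section PushCoord.
Variables (R : realType) (d : nat) (s s' : {fset 'rV[R]_d}).
Variables (b : 'rV[R]_d -> {ptws 'rV[R]_d -> R}) (a : {ptws 'rV[R]_d -> R}).
Hypothesis cell_b : forall w, w \in s' -> cell s (b w).
Hypothesis cell_a : cell s' a.

Lemma sum_push_coord (V : lmodType R) (g : 'rV[R]_d -> V) :
  \sum_(u <- s) push_coord s' b a u *: g u =
  \sum_(w <- s') a w *: \sum_(u <- s) b w u *: g u.
Proof.
under eq_bigr do rewrite scaler_suml.
rewrite exchange_big; apply: eq_bigr => w _; rewrite scaler_sumr.
by apply: eq_bigr => u _; rewrite scalerA.
Qed.

Lemma cell_push_coord : cell s (push_coord s' b a).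
Proof.
have [a_ge0 _ a1] := cell_a; split=> [u|u us|].
- rewrite /push_coord big_seq; apply: sumr_ge0 => w /cell_b[b_ge0 _ _].
  exact: mulr_ge0.
- rewrite /push_coord big_seq big1 // => w /cell_b[_ b0 _].
  by rewrite b0 ?mulr0.
(* The total weight is the case of the constant function 1, with [R] viewed as a module over
   itself. *)
- have scale1 (x : R) : x *: (1 : R^o) = x by exact: mulr1.
  have := sum_push_coord (fun=> 1 : R^o).
  under eq_bigr do rewrite /= scale1.
  move=> ->; rewrite -[RHS]a1 big_seq [RHS]big_seq; apply: eq_bigr => w.
  move=> /cell_b[_ _ b1]; under eq_bigr do rewrite /= scale1.
  by rewrite b1 scale1.
Qed.

Lemma bary_push_coord :
  (forall w, w \in s' -> bary (b w) = w) -> bary (push_coord s' b a) = bary a.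
Proof.
move=> bw; rewrite (baryE cell_push_coord) (baryE cell_a).
rewrite (sum_push_coord id) big_seq [RHS]big_seq; apply: eq_bigr => w ws'.
by rewrite -(baryE (cell_b ws')) bw.
Qed.

End PushCoord.

(** Supplies the [b] of [push_coord] for a simplex of a refinement: each vertex of [s'] lies in
    [simplex s], so coordinates can be chosen for it. *)
Lemma simplex_sub_coord (R : realType) (d : nat) (s s' : {fset 'rV[R]_d}) :
  simplex s' `<=` simplex s -> exists b : 'rV[R]_d -> {ptws 'rV[R]_d -> R},
    (forall w, w \in s' -> cell s (b w)) /\
    (forall w, w \in s' -> bary (b w) = w).
Proof.
move=> ss.
have /choice[b bP] : forall w, exists a : {ptws 'rV[R]_d -> R},
    w \in s' -> cell s a /\ bary a = w.
  move=> w; have [ws'|//] := boolP (w \in s'); last by exists (fun=> 0).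
  by have [a ? ?] := ss _ (simplex_vertex ws'); exists a.
by exists b; split=> w /bP[].
Qed.

(** * Vertices of one triangulation, and which of them lie in [A] *)

Section Triangulation.
Variables (R : realType) (d : nat) (X A : set 'rV[R]_d).
Variables (T S : set {fset 'rV[R]_d}).
Hypothesis pl_T : pl_triangulation X A T S.

Lemma realization_vertex v : vertices T v -> realization T (vertex_coord v).
Proof. by exists (fset1 v) => //; apply: cell_vertex_coord; rewrite fset11. Qed.

Lemma bary_inj a a' : realization T a -> realization T a' ->
  bary a = bary a' -> a = a'.
Proof.
by case: pl_T => _ [_ inj _] _ _ ? ?; apply: inj; rewrite in_setE.
Qed.

Lemma vertex_in_X v : vertices T v -> X v.
Proof.
case: pl_T => _ [im _ _] _ _ /realization_vertex /im.
by rewrite /= bary_vertex_coord.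
Qed.

Lemma vertex_mem s v : T s -> v \in s -> vertices T v.
Proof.
case: pl_T => [[[_ closedT] _] _ _ _] Ts vs.
apply: (closedT _ _ Ts); rewrite ?fsub1set //.
by apply/fset0Pn; exists v; rewrite inE.
Qed.

Lemma subcomplex_vertex_in_A v : vertices S v -> A v.
Proof.
case: pl_T => _ _ _ <- Sv.
exists (vertex_coord v); last exact: bary_vertex_coord.
by exists (fset1 v) => //; apply: cell_vertex_coord; rewrite fset11.
Qed.

Lemma cell_support (s : {fset 'rV[R]_d}) v : cell s (vertex_coord v) -> v \in s.
Proof.
case=> _ s0 _; apply: contraT => /s0; rewrite /vertex_coord eqxx => /eqP.
by rewrite oner_eq0.
Qed.

(** As [bary] is injective on the realization, the coordinates placing [v] in the image of [S] can
    only be [vertex_coord v], so [v] is a vertex of a simplex of [S]. *)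
Lemma vertex_in_A v : vertices T v -> A v -> vertices S v.
Proof.
case: (pl_T) => [[_ [[_ closedS] ST]]] _ _ <- Tv [a [s Ss sa]] av.
have av' : a = vertex_coord v.
  apply: bary_inj; [by exists s => //; exact: ST|exact: realization_vertex|].
  by rewrite bary_vertex_coord.
apply: (closedS _ _ Ss); first by apply/fset0Pn; exists v; rewrite inE.
by rewrite fsub1set cell_support // -av'.
Qed.

(** Describes free vertices without [S], so that levels are compared through [T] and the fixed set
    [A]. *)
Lemma free_vertexE v :
  (vertices T `\` vertices S) v <-> vertices T v /\ ~ A v.
Proof.
split=> -[Tv nv]; split=> // ?; apply: nv; first exact: vertex_in_A.
exact: subcomplex_vertex_in_A.
Qed.

Lemma point_coord x : X x -> exists s a, [/\ T s, cell s a & bary a = x].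
Proof.
case: pl_T => _ [_ _ surj] _ _ /surj [a [s Ts sa] ax]; by exists s, a.
Qed.

End Triangulation.

(** * Vertices and p.l. functions under refinement *)

Section Refinement.
Variables (R : realType) (d : nat) (X A : set 'rV[R]_d).
Variables (T S T' S' : set {fset 'rV[R]_d}).
Hypothesis pl_T : pl_triangulation X A T S.
Hypothesis pl_T' : pl_triangulation X A T' S'.
Hypothesis ref : refines T' T.

(* A vertex of [T] is an extreme point of the simplices of [T] containing it,
   hence also of any simplex of [T'] containing it. *)
Lemma refines_vertices : vertices T `<=` vertices T'.
Proof.
move=> v Tv.
have [s' [a [T's' ca av]]] := point_coord pl_T' (vertex_in_X pl_T Tv).
have [s Ts ss] := ref T's'; have [b [cb bw]] := simplex_sub_coord ss.
have cp := cell_push_coord cb ca.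
(* By uniqueness of the coordinates of [v] in [T], those pushed from [s'] are concentrated at
   [v]. *)
have pv : push_coord s' b a = vertex_coord v.
  apply: (bary_inj pl_T); [by exists s|exact: realization_vertex|].
  by rewrite (bary_push_coord cb ca bw) bary_vertex_coord.
have [a0 _ a1] := ca.
have [w ws' aw] : exists2 w, w \in s' & a w != 0.
  apply: contrapT => nw; move: a1; rewrite big_seq big1 => [/eqP|w ws'].
    by rewrite eq_sym oner_eq0.
  by apply: contrapT => /eqP ?; apply: nw; exists w.
suff -> : v = w by exact: (vertex_mem pl_T' T's').
have [b0 bs0 b1] := cb _ ws'.
(* At [u] other than [v], the nonnegative terms [a z * b z u] sum to 0, so each vanishes; for
   [z = w] the factor [a w] is nonzero. *)
have bu u : u != v -> b w u = 0.
  move=> uv; have := congr1 (fun f => f u) pv.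
  rewrite /push_coord /vertex_coord (negPf uv) big_seq => /eqP.
  rewrite psumr_eq0; last first.
    by move=> z zs'; apply: mulr_ge0 => //; have [] := cb _ zs'.
  move=> /allP /(_ w ws'); rewrite ws' /= mulf_eq0 (negPf aw) /=.
  by move=> /eqP.
have vs : v \in s.
  apply: contraT => vs; move: b1; rewrite big_seq big1 => [/eqP|u us].
    by rewrite eq_sym oner_eq0.
  by apply: bu; apply: contraNneq vs => <-.
have bv : b w v = 1.
  by rewrite -b1 (bigD1_seq v) ?fset_uniq //= big1 ?addr0.
apply: etrans (bw _ ws'); rewrite -[LHS]bary_vertex_coord; congr bary.
apply/funext => u; rewrite /vertex_coord.
by have [->|/bu ->] := eqVneq u v; rewrite ?bv.
Qed.

Lemma refines_pl_function f : pl_function T f -> pl_function T' f.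
Proof.
move=> plf s' a T's' ca.
have [s Ts ss] := ref T's'; have [b [cb bw]] := simplex_sub_coord ss.
rewrite -(bary_push_coord cb ca bw) (plf s) //; last exact: cell_push_coord.
have := @sum_push_coord R d s s' b a R^o f; rewrite /GRing.scale /= => ->.
rewrite big_seq [RHS]big_seq; apply: eq_bigr => w ws'; congr (_ * _).
by rewrite -(plf s) ?bw //; exact: cb.
Qed.

End Refinement.

(** * Nested triangulations and Schauder functions at vertices *)

Section NestedTriangulation.
Variables (R : realType) (d : nat) (X A : set 'rV[R]_d).
Variables (T S : nat -> set {fset 'rV[R]_d}).
Hypothesis hTS : nested_triangulation X A T S.

Lemma nested_vertices m n : (m <= n)%N -> vertices (T m) `<=` vertices (T n).
Proof.
have [plT refT _] := hTS => /subnK <-; elim: (n - m)%N => //= k IH.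
apply: subset_trans IH _; exact: (refines_vertices (plT _) (plT _) (refT _)).
Qed.

Lemma nested_pl_function m n f :
  (m <= n)%N -> pl_function (T m) f -> pl_function (T n) f.
Proof.
have [_ refT _] := hTS => /subnK <-; elim: (n - m)%N => //= k IH plf.
exact: (refines_pl_function (refT _) (IH plf)).
Qed.

Lemma nested_free_vertexE n v :
  free_vertices T S n v <-> vertices (T n) v /\ ~ A v.
Proof. by have [plT _ _] := hTS; exact: (free_vertexE (plT n)). Qed.

Lemma new_vertices_free n : new_vertices T S n `<=` free_vertices T S n.
Proof. by case: n => [//|n] v []. Qed.

(** The definition removes only the preceding level, but vertex sets increase, so all earlier levels
    go with it. *)
Lemma new_vertices_not_old m n v :
  (m < n)%N -> new_vertices T S n v -> ~ vertices (T m) v.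
Proof.
case: n => // n; rewrite ltnS => mn /= [/nested_free_vertexE[_ nAv] nfv] Tmv.
apply: nfv; apply/nested_free_vertexE; split=> //; exact: nested_vertices Tmv.
Qed.

Section Basis.
Variables (L : nat -> R) (K : 'rV[R]_d -> 'rV[R]_d -> R).
Hypothesis hK : schauder_basis X A T S L K.

Lemma schauder_vertex0 m n v v' : (m <= n)%N -> vertices (T m) v ->
  new_vertices T S n v' -> v <> v' -> K v' v = 0.
Proof.
move=> mn Tv nv' vv'; have [KA _ K0 _ _] := hK nv'.
have [/KA//|nAv] := pselect (A v).
apply: K0 => //; apply/nested_free_vertexE; split=> //.
exact: nested_vertices Tv.
Qed.

(* For [v] of level [n + 1], the points and weights are the barycentric
   coordinates of [v] in [T n]; for [v] of level [0] there are none. *)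
Lemma schauder_prediction v : all_free_vertices T S v ->
  exists s : seq ({nonneg R} * 'rV[R]_d),
    (forall p, p \in s -> X p.2 /\ p.2 <> v) /\
    forall v', all_free_vertices T S v' -> v' <> v ->
      K v' v = \sum_(p <- s) p.1%:num * K v' p.2.
Proof.
have [plT _ _] := hTS.
move=> [[|n] _ nv].
  (* At level 0, [v] is a vertex of every [T m], so the other basis functions vanish there. *)
  exists [::]; split=> // v' [m _ nv'] v'v; rewrite big_nil.
  have /nested_free_vertexE[Tv _] := nv.
  by apply: (@schauder_vertex0 0 m) => // /esym.
have /new_vertices_free/nested_free_vertexE[Tv nAv] := nv.
have [s [a [Ts ca av]]] := point_coord (plT n) (vertex_in_X (plT _) Tv).
have [a0 _ _] := ca.
have Tns w : w \in s -> vertices (T n) w by exact: (vertex_mem (plT n) Ts).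
exists [seq (NngNum (a0 w), w) | w <- s]; split=> [_ /mapP[w /Tns Tw ->]/=|].
  split; first exact: (vertex_in_X (plT _) Tw).
  by move=> wv; apply: (new_vertices_not_old (ltnSn n) nv); rewrite -wv.
move=> v' [m _ nv'] v'v; rewrite big_map /=.
(* If [v'] appears after level [n], then [K v'] vanishes at [v] and on [s]; otherwise it is p.l. on
   [T n] and its value at [v] is the barycentric combination. *)
have [nm|mn] := ltnP n m.
  rewrite (@schauder_vertex0 n.+1 m) //; last by move/esym.
  rewrite big_seq big1 // => w /Tns Tw.
  rewrite (@schauder_vertex0 n m) ?mulr0 //; first exact: ltnW.
  by move=> wv'; apply: (new_vertices_not_old nm nv'); rewrite -wv'.
have [_ plK _ _ _] := hK nv'.
by rewrite -{1}av (nested_pl_function mn plK Ts ca).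
Qed.

End Basis.
End NestedTriangulation.

(** * Euclidean distance, closed sets and Borel measurability *)

Notation borel R d := (g_sigma_algebraType (@open 'rV[R]_d)).

Section EuclideanDistance.
Variables (R : realType) (d : nat).
Implicit Types (x y v : 'rV[R]_d) (A X U : set 'rV[R]_d).

Lemma edist_ge0 x y : 0 <= edist x y.
Proof. exact: sqrtr_ge0. Qed.

Lemma edistxx x : edist x x = 0.
Proof.
by rewrite /edist big1 ?sqrtr0 // => i _; rewrite subrr expr0n.
Qed.

Lemma norm_le_edist x y : `|x - y| <= edist x y.
Proof.
rewrite (_ : `|x - y| = mx_norm (x - y)) // mx_normrE.
apply: bigmax_le; rewrite ?edist_ge0 //.
move=> [i j] _ /=; rewrite !mxE (ord1 i) -sqrtr_sqr ler_wsqrtr //.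
rewrite (bigD1 j) //= lerDl; apply: sumr_ge0 => k _; exact: sqr_ge0.
Qed.

Lemma continuous_edist x : continuous (fun y => edist y x).
Proof.
have cb i : continuous (fun y : 'rV[R]_d => y ord0 i - x ord0 i).
  move=> y; apply: continuousB; first exact: coord_continuous.
  exact: cst_continuous.
have cs : continuous (fun y => \sum_(i < d) (y ord0 i - x ord0 i) ^+ 2).
  apply: continuous_big => [|i _ y]; first exact: add_continuous.
  exact: (continuous_comp (cb i y) (@exprn_continuous R 2 _)).
move=> y; exact: (continuous_comp (cs y) (@sqrt_continuous R _)).
Qed.

Lemma dist_to_ge0 A x : A !=set0 -> 0 <= dist_to A x.
Proof.
move=> [a Aa]; apply: lb_le_inf; first by exists (edist x a), a.
by move=> _ [b _ <-]; exact: edist_ge0.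
Qed.

Lemma dist_to_gt0 A x : A !=set0 -> closed A -> ~ A x -> 0 < dist_to A x.
Proof.
move=> [a Aa] cA nAx.
have /nbhs_ballP[e /= e0 eA] : nbhs x (~` A).
  by apply: open_nbhs_nbhs; split => //; exact: closed_openC.
apply: (lt_le_trans e0); apply: lb_le_inf; first by exists (edist x a), a.
move=> _ [b Ab <-]; rewrite leNgt; apply/negP => be.
apply: (eA b) => //; rewrite -ball_normE /=.
exact: le_lt_trans (norm_le_edist _ _) be.
Qed.

Lemma closed_polyhedron X : polyhedron X -> closed X.
Proof.
move=> [m [H [Hhs ->]]]; apply: closed_bigI => i _.
have [a [b [_ ->]]] := Hhs i.
apply: (@closed_comp _ _ (fun x : 'rV[R]_d => \sum_(i < d) a ord0 i * x ord0 i)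
  [set r | r <= b]); last exact: closed_le.
move=> x _; move: x.
apply: continuous_big => [|k _ x]; first exact: add_continuous.
by apply: continuousM; [exact: cst_continuous|exact: coord_continuous].
Qed.

Lemma polyhedral_pair_closed X A :
  polyhedral_pair X A -> closed X /\ closed A.
Proof.
move=> [/closed_polyhedron cX _ _ [m [P [PP ->]]]]; split=> //.
apply: closed_bigcup; first exact: finite_finset.
by move=> i _; apply: closed_polyhedron; case: (PP i).
Qed.

Lemma open_borel U : open U -> measurable (U : set (borel R d)).
Proof. by move=> oU; apply: sub_sigma_algebra. Qed.

Lemma closed_borel U : closed U -> measurable (U : set (borel R d)).
Proof.
move=> cU; rewrite -[U]setCK; apply: measurableC; apply: open_borel.
exact: closed_openC.
Qed.

Lemma borel_set1 v : measurable ([set v] : set (borel R d)).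
Proof.
apply: closed_borel; apply: compact_closed; last exact: compact_set1.
exact: norm_hausdorff.
Qed.

(** Open lower rays generate the Borel sets of the line, so relatively open sublevel sets
    suffice. *)
Lemma measurable_fun_open_lt X (f : borel R d -> R) : closed X ->
  (forall r, exists2 U, open U & X `&` [set x | f x < r] = X `&` U) ->
  measurable_fun (X : set (borel R d)) f.
Proof.
move=> /closed_borel mX fo _.
apply: (measurability _ (RGenInftyO.measurableE R)) => //.
move=> _ [_ [r ->] <-]; have [U oU fU] := fo r.
rewrite (_ : _ `&` _ = X `&` U).
  by apply: measurableI => //; exact: open_borel.
by rewrite -fU; apply/seteqP; split=> x [Xx] /=; rewrite in_itv.
Qed.

Lemma measurable_dist_to X A : closed X -> A !=set0 ->
  measurable_fun (X : set (borel R d)) (dist_to A : borel R d -> R).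
Proof.
move=> cX A0; apply: measurable_fun_open_lt => // r.
exists (\bigcup_(a in A) [set x | edist x a < r]).
  apply: bigcup_open => a _.
  apply: (@open_comp _ _ (fun x => edist x a) [set s | s < r]).
    by move=> x _; exact: continuous_edist.
  exact: open_lt.
congr (_ `&` _); apply/seteqP; split=> [x /= xr|x [a Aa /= xa]].
  have [a0 Aa0] := A0.
  have [|_ [a Aa <-] ar] := inf_lt _ xr; first by exists (edist x a0), a0.
  by exists a.
apply: le_lt_trans xa; apply: ge_inf; last by exists a.
by exists 0 => _ [b _ <-]; exact: edist_ge0.
Qed.

Lemma lipschitz_measurable X (f : 'rV[R]_d -> R) c : closed X ->
  lipschitz_const X f c ->
  measurable_fun (X : set (borel R d)) (f : borel R d -> R).
Proof.
move=> cX [c0 fc]; apply: measurable_fun_open_lt => // r.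
(* On [X] the Lipschitz bound [f x <= f a + c * edist x a] keeps each of these open sets in the
   sublevel set; the choice [a = x] gives the cover. *)
exists (\bigcup_(a in X `&` [set a | f a < r])
  [set x | f a + c * edist x a < r]).
  apply: bigcup_open => a _.
  have cd : continuous (fun x : 'rV[R]_d => f a + c * edist x a).
    have ca : continuous (fun t : R => f a + c * t).
      move=> t; apply: cvgD; first exact: cvg_cst.
      by apply: cvgM; [exact: cvg_cst|exact: cvg_id].
    by move=> x; exact: (continuous_comp (@continuous_edist a x) (ca _)).
  apply: (@open_comp _ _ _ [set s | s < r]) => [x _|]; first exact: cd.
  exact: open_lt.
apply/seteqP; split=> [x /= [Xx xr]|x [Xx [a [Xa ar] /= xa]]]; split=> //.
  by exists x => //=; rewrite edistxx mulr0 addr0.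
apply: le_lt_trans xa; rewrite -lerBlDl; apply: le_trans (fc _ _ Xx Xa).
exact: ler_norm.
Qed.

End EuclideanDistance.

(** * Finite nonnegative combinations of point masses *)

Section WeightedDirac.
Variables (R : realType) (d : nat).
Implicit Types (s : seq ({nonneg R} * 'rV[R]_d)) (X A : set 'rV[R]_d).

Fixpoint weighted_dirac s : borel_measure R d :=
  if s is p :: s' then
    measure_add (mscale p.1 (dirac (p.2 : borel R d))) (weighted_dirac s')
  else mzero.

Lemma weighted_diracE s (E : set (borel R d)) :
  weighted_dirac s E = (\sum_(p <- s) p.1%:num * \1_E p.2)%:E.
Proof.
elim: s => [|p s IH]; first by rewrite big_nil.
by rewrite big_cons [LHS]measure_addE IH EFinD EFinM indicE -diracE.
Qed.

Lemma ge0_integral_weighted_dirac s X (f : borel R d -> \bar R) :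
  closed X -> (forall p, p \in s -> X p.2) ->
  measurable_fun (X : set (borel R d)) f -> (forall x, X x -> 0 <= f x)%E ->
  (\int[weighted_dirac s]_(x in X) f x = \sum_(p <- s) p.1%:num%:E * f p.2)%E.
Proof.
move=> /closed_borel mX; elim: s => [|p s IH] sX mf f0.
  by rewrite big_nil /= integral_measure_zero.
rewrite big_cons /= ge0_integral_measure_add // IH //; last first.
  by move=> q qs; apply: sX; rewrite inE qs orbT.
rewrite ge0_integral_mscale // integral_dirac // diracE mem_set ?mul1e //.
by apply: sX; rewrite inE eqxx.
Qed.

Lemma integral_weighted_dirac s X (f : borel R d -> R) :
  closed X -> (forall p, p \in s -> X p.2) ->
  measurable_fun (X : set (borel R d)) f ->
  (\int[weighted_dirac s]_(x in X) (f x)%:E =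
    (\sum_(p <- s) p.1%:num * f p.2)%:E)%E.
Proof.
move=> cX sX /measurable_EFinP mf; rewrite integralE.
rewrite !ge0_integral_weighted_dirac //.
- have -> : (fun x => (f x)%:E) = EFin \o f by [].
  rewrite funerpos funerneg /=.
  under eq_bigr do rewrite -EFinM.
  under [X in (_ - X)%E]eq_bigr do rewrite -EFinM.
  rewrite !sumEFin -EFinB -sumrB; congr (_%:E); apply: eq_bigr => p _.
  by rewrite -mulrBr -[in RHS](funrposBneg f).
- exact: measurable_funeneg.
- exact: measurable_funepos.
Qed.

Lemma weighted_dirac_M1plus s X A : closed X -> A !=set0 ->
  (forall p, p \in s -> X p.2) -> in_M1plus X A (weighted_dirac s).
Proof.
move=> cX A0 sX.
have carr : carried_by X (weighted_dirac s).
  rewrite /carried_by weighted_diracE big_seq big1 // => p /sX Xp.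
  by rewrite indicE memNset ?mulr0 //; exact.
split=> //.
  exists (weighted_dirac s); split=> //.
    by exists mzero, mzero; split.
  move=> E mE; apply/eqP; rewrite eq_le; apply/andP; split; last first.
    apply: ge_ereal_sup => _ [C [cC CE] <-].
    apply: le_measure => //; rewrite inE //.
    apply: closed_borel; exact: (compact_closed (@norm_hausdorff _ _) cC).
  (* The supremum is attained: the support points in [E] form a finite, hence compact, set carrying
     all the mass of [E]. *)
  apply: ereal_sup_ubound; exists (E `&` [set` [seq p.2 | p <- s]]).
    split; last exact: subIsetl.
    by apply: finite_compact; apply: finite_setIr; exact: finite_seq.
  rewrite !weighted_diracE; congr (_%:E); rewrite big_seq [RHS]big_seq.
  apply: eq_bigr => p ps; rewrite !indicE in_setI.
  by rewrite [X in _ && X]mem_set ?andbT //=; apply/mapP; exists p.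
(* [X] itself serves as the neighborhood, since the integral is a finite sum of reals. *)
move=> x Xx; exists X, (closed_borel cX); split=> //.
  by rewrite /within /=; exact: nearW.
rewrite (eq_measure_integral (weighted_dirac s)); last first.
  by move=> E mE EX; rewrite /= /mrestr setIidl.
rewrite integral_weighted_dirac ?ltry //.
exact: measurable_dist_to.
Qed.

End WeightedDirac.

(** * Mass at a point of [X] off [A] *)

Section PointMass.
Variables (R : realType) (d : nat) (X A : set 'rV[R]_d).
Hypotheses (cX : closed X) (cA : closed A) (A0 : A !=set0).
Variable v : 'rV[R]_d.
Hypotheses (Xv : X v) (nAv : ~ A v).

Lemma M1plus_point_finite gamma : in_M1plus X A gamma ->
  gamma [set v] \is a fin_num.
Proof.
move=> [_ _ /(_ v Xv)[U [mU [UX nU iU]]]].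
have mX := closed_borel cX; have m1 := borel_set1 v.
have Uv : U v.
  have := nbhs_singleton nU; exact.
have dv := dist_to_gt0 A0 cA nAv.
rewrite ge0_fin_numE ?measure_ge0 //.
(* Markov's inequality at one point: the integral over [U] bounds its part over [[set v]]. *)
have : ((dist_to A v)%:E * gamma [set v] < +oo)%E.
  apply: le_lt_trans iU.
  have -> : gamma [set v] = mrestr gamma mU [set v].
    by rewrite /mrestr setIidl // => _ ->.
  rewrite -(integral_cst (mrestr gamma mU) m1).
  rewrite (eq_integral (fun y : borel R d => (dist_to A y)%:E)); last first.
    by move=> y; rewrite inE => ->.
  apply: ge0_subset_integral => //.
  - by apply/measurable_EFinP; exact: measurable_dist_to.
  - by move=> y _; rewrite lee_fin dist_to_ge0.
  - by move=> _ ->.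
have [->|] := eqVneq (gamma [set v]) +oo%E; last by rewrite ltey.
by rewrite gt0_muley ?lte_fin.
Qed.

(** The two correcting measures live on [A] and do not charge [v], so the mass at [v] is an
    invariant of the relative class. *)
Lemma rel_eq_point (mu nu : borel_measure R d) :
  rel_eq A mu nu -> mu [set v] = nu [set v].
Proof.
move=> [a [b [a0 b0 ab]]]; have m1 := borel_set1 v.
have z (c : borel_measure R d) : carried_by A c -> c [set v] = 0%E.
  move=> c0; apply: (subset_measure0 m1 _ _ c0); last by move=> _ ->.
  by apply: measurableC; exact: closed_borel.
by have := ab _ m1; rewrite (z a) // (z b) // !adde0.
Qed.

End PointMass.

Theorem theorem6p4 (R : realType) (d : nat) (X A : set 'rV[R]_d)
  (T S : nat -> set {fset 'rV[R]_d}) (L : nat -> R)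
  (K : 'rV[R]_d -> 'rV[R]_d -> R)
  (hXA : polyhedral_pair X A)
  (hTS : nested_triangulation X A T S)
  (hL0 : forall n, 0 < L n)
  (hL : cvgn (series L))
  (hK : schauder_basis X A T S L K) :
  forall v, all_free_vertices T S v ->
    exists alpha beta : M1 X A,
      ~ M1_eq alpha beta /\
      forall v', all_free_vertices T S v' -> v' <> v ->
        M1_eval alpha (K v') = M1_eval beta (K v').
Proof.
move=> v hv; have [cX cA] := polyhedral_pair_closed hXA.
have [_ A0 _ _] := hXA; have [plT _ _] := hTS.
have [Xv nAv] : X v /\ ~ A v.
  have [n _ nv] := hv.
  have [Tv nAv] := (nested_free_vertexE hTS n v).1 (new_vertices_free nv).
  by split=> //; exact: (vertex_in_X (plT n)).
have [s [sXv sK]] := schauder_prediction hTS hK hv.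
have sX p : p \in s -> X p.2 by case/sXv.
(* [t] is the unit mass at [v] and [s] its prediction from older vertices; both weights are
   nonnegative, so both negative parts are zero. *)
pose t : seq ({nonneg R} * 'rV[R]_d) := [:: (NngNum (@ler01 R), v)].
have tX p : p \in t -> X p.2 by rewrite inE => /eqP ->.
have null : in_M1plus X A (weighted_dirac [::]).
  exact: weighted_dirac_M1plus.
exists (MkM1 (weighted_dirac_M1plus cX A0 tX) null).
exists (MkM1 (weighted_dirac_M1plus cX A0 sX) null); split.
- have addE (m1 m2 : borel_measure R d) E :
      (measure_add m1 m2 : borel_measure R d) E = (m1 E + m2 E)%E.
    exact: measure_addE.
  have tv : weighted_dirac t [set v] = 1%E.
    by rewrite weighted_diracE /t big_seq1 indicE mem_set // mulr1.
  have sv : weighted_dirac s [set v] = 0%E.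
    rewrite weighted_diracE big_seq big1 // => p /sXv[_ pv].
    by rewrite indicE memNset ?mulr0.
  have nil0 : weighted_dirac [::] [set v] = 0%E.
    by rewrite weighted_diracE big_nil.
  move=> [gamma gammaM /(rel_eq_point cA nAv)]; rewrite /M1_pos /M1_neg.
  have := M1plus_point_finite cX cA A0 Xv nAv gammaM.
  move: tv sv nil0.
  move: (weighted_dirac _) (weighted_dirac _) (weighted_dirac _) => m1 m2 m3.
  (* At [v] the relation reads 1 + 0 + g = 0 + 0 + g with g = [gamma [set v]] finite, which is
     absurd in [R]. *)
  move=> e1 e2 e3; rewrite !addE e1 e2 e3 => /fineK <-.
  by rewrite -!EFinD => -[]; lra.
move=> v' hv' v'v; have [m _ nv'] := hv'.
have [_ _ _ _ [lipK _]] := hK _ _ nv'.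
have mK := lipschitz_measurable cX lipK.
rewrite /M1_eval /M1_pos /M1_neg !integral_weighted_dirac //.
by rewrite /t big_seq1 mul1r /= (sK _ hv').
Qed.
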